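(* For all integers $n,m\ge0$ and every $x$, \[ \mathcal{C}_{n,m}^{(k)}(a,q,L;x)=\sum_{j=0}^{n}(-1)^{n-j}\binom{n}{j}\mathcal{C}_{j,m}^{(k)}(a,q,L)\,(x)_{q,n-j}. \]
   Context: Let $k\ge1$ be an integer, $a,q,l_1,\dots,l_k$ nonzero reals, $l=\prod l_i$, $L=(l_1,\dots,l_k)$; denominators $a+j$ ($j\ge0$ integer) assumed nonzero and $l^{a+i}$ means $l^al^i$. Let $s(n,i)$ be the signed Stirling numbers of the first kind ($\frac{1}{i!}(\ln(1+x))^i=\sum_{n\ge i}s(n,i)\frac{x^n}{n!}$), $\mathcal{C}_{n,m}^{(k)}(a,q,L)=\frac{(a+m)^k}{a^k}\sum_{i=0}^{n}s(n,i)\frac{q^{n-i}l^{a+i}}{(a+i+m)^k}$, $\operatorname{Lif}_k(w;b)=\sum_{n\ge0}\frac{1}{(n+b)^k}\frac{w^n}{n!}$, and $(x)_{q,n}=x(x+q)\cdots(x+(n-1)q)$ with $(x)_{q,0}=1$. The generalized $m$-poly-Cauchy polynomials of the first kind are defined by the formal power series identity in $z$ \[ \frac{l^a(a+m)^k}{a^k(1+qz)^{x/q}}\operatorname{Lif}_k\!\Big(\frac{l\ln(1+qz)}{q};a+m\Big)=\sum_{n\ge0}\mathcal{C}_{n,m}^{(k)}(a,q,L;x)\frac{z^n}{n!}. \] *)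

(* Defs.v *)
From HB Require Import structures.
From mathcomp Require Import all_boot all_order all_algebra.
From mathcomp Require Import reals topology normedtype sequences exp trigo.
From mathcomp.real_closed Require Import complex.

Set Implicit Arguments.
Unset Strict Implicit.
Unset Printing Implicit Defensive.

Import Order.TTheory GRing.Theory Num.Theory.
Local Open Scope ring_scope.
Local Open Scope complex_scope.

(* A formal power series \sum_n f_n z^n is its coefficient sequence n |-> f_n. *)
Definition fps (F : fieldType) := nat -> F.

Section FormalPowerSeries.
Variable F : fieldType.
Implicit Types f g : fps F.

Definition fps_one : fps F := fun n => (n == 0%N)%:R.

Definition fps_scale (c : F) f : fps F := fun n => c * f n.

Definition fps_mul f g : fps F := fun n => \sum_(i < n.+1) f i * g (n - i)%N.

Definition fps_exp f (i : nat) : fps F := iter i (fps_mul f) fps_one.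

(* f(c z) *)
Definition fps_dilate (c : F) f : fps F := fun n => c ^+ n * f n.

(* f(g(z)); meaningful only when g has zero constant term, in which case
   g^i does not contribute to the coefficient of z^n for i > n. *)
Definition fps_comp f g : fps F :=
  fun n => \sum_(i < n.+1) f i * fps_exp g i n.

(* The first n.+1 coefficients of 1/f (for f with nonzero constant term),
   from h_0 = 1/f_0 and h_{n+1} = - (1/f_0) \sum_{i <= n} f_{i+1} h_{n-i}. *)
Fixpoint fps_inv_seq f (n : nat) : seq F :=
  if n is p.+1 then
    let s := fps_inv_seq f p in
    rcons s (- (f 0%N)^-1 * \sum_(i < p.+1) f i.+1 * s`_(p - i))
  else [:: (f 0%N)^-1].

Definition fps_inv f : fps F := fun n => (fps_inv_seq f n)`_n.

(* ln (1 + z) = \sum_{n >= 1} (-1)^(n-1) z^n / n *)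
Definition fps_ln1p : fps F :=
  fun n => if n is p.+1 then (-1) ^+ p / p.+1%:R else 0.

(* (1 + z)^s = \sum_n s (s - 1) ... (s - n + 1) z^n / n! *)
Definition fps_pow1p (s : F) : fps F :=
  fun n => (\prod_(i < n) (s - i%:R)) / n`!%:R.

(* Lif_k(w; b), as a series in w *)
Definition fps_Lif (k : nat) (b : F) : fps F :=
  fun n => ((n%:R + b) ^+ k)^-1 / n`!%:R.

(* Signed Stirling numbers of the first kind, read off from
   (ln (1 + x))^i / i! = \sum_n s(n, i) x^n / n!. *)
Definition stirling1 (n i : nat) : F :=
  n`!%:R * (fps_exp fps_ln1p i n / i`!%:R).

(* (x)_{q,n} = x (x + q) ... (x + (n - 1) q) *)
Definition qrising (q x : F) (n : nat) : F := \prod_(i < n) (x + i%:R * q).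

End FormalPowerSeries.

Section PolyCauchy.
Variable R : realType.

Definition cis (t : R) : R[i] := cos t +i* sin t.

(* c is a determination of the power l^a (l a nonzero real, possibly negative):
   c = |l|^a e^{i a t} where t is an argument of l.  For l > 0 and t = 0 this
   is the usual real power. *)
Definition is_power (l a : R) (c : R[i]) : Prop :=
  exists t : R, l%:C = `|l|%:C * cis t /\ c = (`|l| `^ a)%:C * cis (a * t).

(* In the definitions below la stands for l^a. *)
Variables (k m : nat) (a q : R) (L : k.-tuple R) (la : R[i]).

Definition lprod : R := \prod_(i < k) tnth L i.

Definition polyCauchy_number (n : nat) : R[i] :=
  (a%:C + m%:R) ^+ k / a%:C ^+ k *
  \sum_(i < n.+1)
     stirling1 R[i] n i *
     (q%:C ^+ (n - i) * (la * lprod%:C ^+ i) / (a%:C + i%:R + m%:R) ^+ k).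

Definition polyCauchy_genfun (x : R[i]) : fps R[i] :=
  fps_scale (la * (a%:C + m%:R) ^+ k / a%:C ^+ k)
    (fps_mul
       (fps_inv (fps_dilate q%:C (fps_pow1p (x / q%:C))))
       (fps_comp (fps_Lif k (a%:C + m%:R))
          (fps_scale (lprod%:C / q%:C) (fps_dilate q%:C (fps_ln1p R[i]))))).

(* The generating function is \sum_n C_n(x) z^n / n!. *)
Definition polyCauchy_poly (n : nat) (x : R[i]) : R[i] :=
  n`!%:R * polyCauchy_genfun x n.

End PolyCauchy.

(* Main.v *)
Require Import Defs.
From HB Require Import structures.
From mathcomp Require Import all_boot all_order all_algebra.
From mathcomp Require Import reals.
From mathcomp.real_closed Require Import complex.
From mathcomp Require Import ring.

(* By Chu-Vandermonde, 1 / (1 + qz)^(x/q) = (1 + qz)^(-x/q), whose coefficient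
   of z^n / n! is (-1)^n (x)_{q,n}.  Expanding Lif_k (l ln(1 + qz) / q; a + m)
   in powers of ln (1 + qz) produces the Stirling numbers, so the remaining
   factor is the exponential generating function of the C_{n,m}.  The theorem is
   the binomial convolution of the two. *)

Import Order.TTheory GRing.Theory Num.Theory.
Local Open Scope ring_scope.
Local Open Scope complex_scope.

Section FormalPowerSeriesTheory.
Variable F : fieldType.
Implicit Types f g : fps F.

Lemma size_fps_inv_seq f n : size (fps_inv_seq f n) = n.+1.
Proof. by elim: n => //= n IHn; rewrite size_rcons IHn. Qed.

(** Each stage of [fps_inv_seq] only appends an entry, so coefficients once computed never
    change. *)
Lemma nth_fps_inv_seq f n i :
  (i <= n)%N -> (fps_inv_seq f n)`_i = fps_inv f i.
Proof.
elim: n => [|n IHn]; first by rewrite leqn0 => /eqP ->.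
rewrite leq_eqVlt => /predU1P[-> //|lt_in].
by rewrite /= nth_rcons size_fps_inv_seq lt_in IHn.
Qed.

Lemma fps_invS f n : fps_inv f n.+1 =
  - (f 0%N)^-1 * \sum_(i < n.+1) f i.+1 * fps_inv f (n - i)%N.
Proof.
rewrite {1}/fps_inv /= nth_rcons size_fps_inv_seq ltnn eqxx.
by congr (_ * _); apply: eq_bigr => i _; rewrite nth_fps_inv_seq ?leq_subr.
Qed.

(** Since [f 0] is invertible, the coefficient of z^(n+1) in f g = 1 can be solved for g_(n+1),
    which gives the recursion of [fps_invS]. It involves all earlier coefficients, hence the strong
    induction. *)
Lemma fps_inv_unique f g :
  f 0%N != 0 -> fps_mul f g =1 fps_one F -> g =1 fps_inv f.
Proof.
move=> f0 fg1 n; have [p] := ubnP n; elim: p n => // p IHp [|n] lt_np.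
  have := fg1 0%N; rewrite /fps_mul big_ord1 /fps_one eqxx subn0 => fg0.
  by apply: (mulfI f0); rewrite fg0 /fps_inv /= mulfV.
rewrite fps_invS; have := fg1 n.+1; rewrite /fps_mul big_ord_recl /= subn0.
rewrite /fps_one /= => /eqP; rewrite addr_eq0 => /eqP fgS.
apply: (mulfI f0); rewrite fgS mulrA mulrN mulfV // mulN1r; congr (- _).
by apply: eq_bigr => i _; rewrite subSS IHp // (leq_ltn_trans (leq_subr _ _)).
Qed.

Lemma fps_mul_dilate c f g n :
  fps_mul (fps_dilate c f) (fps_dilate c g) n = fps_dilate c (fps_mul f g) n.
Proof.
rewrite /fps_mul /fps_dilate mulr_sumr; apply: eq_bigr => -[i /= le_in] _.
by rewrite mulrACA -exprD subnKC.
Qed.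

Lemma fps_exp_dilate c f i n :
  fps_exp (fps_dilate c f) i n = fps_dilate c (fps_exp f i) n.
Proof.
elim: i n => [|i IHi] n.
  by rewrite /fps_dilate /= /fps_one; case: n => [|n]; rewrite ?mulr0 ?expr0 ?mul1r.
by rewrite /= -fps_mul_dilate; apply: eq_bigr => j _; rewrite -IHi.
Qed.

Lemma fps_exp_scale c f i n :
  fps_exp (fps_scale c f) i n = c ^+ i * fps_exp f i n.
Proof.
elim: i n => [|i IHi] n; first by rewrite mul1r.
rewrite [fps_exp f _]/= /= /fps_mul mulr_sumr; apply: eq_bigr => j _.
by rewrite -/(fps_exp _ i) IHi /fps_scale exprS mulrACA.
Qed.

End FormalPowerSeriesTheory.

Section CharacteristicZero.
Variable F : numFieldType.

Let natS_neq0 n : n.+1%:R != 0 :> F. Proof. by rewrite pnatr_eq0. Qed.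
Let fact_neq0 n : n`!%:R != 0 :> F.
Proof. by rewrite pnatr_eq0 -lt0n fact_gt0. Qed.

Lemma fps_pow1p0 (s : F) : fps_pow1p s 0%N = 1.
Proof. by rewrite /fps_pow1p big_ord0 divr1. Qed.

Lemma fps_pow1pS (s : F) n :
  n.+1%:R * fps_pow1p s n.+1 = (s - n%:R) * fps_pow1p s n.
Proof.
rewrite /fps_pow1p big_ord_recr /= factS natrM; set P := \prod_(_ < _) _.
by field; rewrite fact_neq0 nat1r natS_neq0.
Qed.

(* Both sides satisfy (n + 1) c_(n+1) = (s + t - n) c_n. *)
Lemma fps_pow1pD (s t : F) :
  fps_mul (fps_pow1p s) (fps_pow1p t) =1 fps_pow1p (s + t).
Proof.
elim=> [|n IHn]; first by rewrite /fps_mul big_ord1 !fps_pow1p0 mulr1.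
apply: (mulfI (natS_neq0 n)); rewrite fps_pow1pS -IHn /fps_mul.
set f := fps_pow1p s; set g := fps_pow1p t.
(* Splitting n + 1 = i + (n + 1 - i) is the product rule for z d/dz, read on coefficients. *)
have -> : n.+1%:R * (\sum_(i < n.+2) f i * g (n.+1 - i)%N) =
    \sum_(i < n.+2) i%:R * f i * g (n.+1 - i)%N
    + \sum_(i < n.+2) f i * ((n.+1 - i)%:R * g (n.+1 - i)%N).
  rewrite mulr_sumr -big_split; apply: eq_bigr => -[i /= le_in] _.
  by rewrite -{1}(subnKC (ltnSE le_in)) natrD; ring.
(* The first sum loses its term i = 0 and the second its term i = n + 1. After a shift both run over
   i <= n, and the recurrences combine through (s - i) + (t - (n - i)) = s + t - n. *)
rewrite big_ord_recl !mul0r add0r [X in _ + X]big_ord_recr /= subnn mul0r mulr0.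
rewrite addr0 -big_split mulr_sumr; apply: eq_bigr => -[i /= le_in] _.
rewrite /bump /= add1n subSS subSn // /f /g !fps_pow1pS natrB //.
ring.
Qed.

Lemma fps_inv_pow1p_dilate (c s : F) :
  fps_inv (fps_dilate c (fps_pow1p s)) =1 fps_dilate c (fps_pow1p (- s)).
Proof.
move=> n; apply/esym/fps_inv_unique.
  by rewrite /fps_dilate fps_pow1p0 mulr1 oner_neq0.
move=> {}n; rewrite fps_mul_dilate /fps_dilate fps_pow1pD subrr.
case: n => [|n]; first by rewrite fps_pow1p0 mulr1.
(* The exponent is now 0, so the factor of index 0 in the product vanishes. *)
by rewrite /fps_pow1p big_ord_recl subrr mul0r mul0r mulr0.
Qed.

Lemma fps_pow1p_dilate_qrising (q x : F) n : q != 0 ->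
  fps_dilate q (fps_pow1p (- (x / q))) n = (-1) ^+ n * qrising q x n / n`!%:R.
Proof.
move=> q0; rewrite /fps_dilate /fps_pow1p mulrA; congr (_ / _).
(* The powers become constant products over ['I_n], which reduces the claim to q (- x / q - i) = -
   (x + i q) for each factor. *)
rewrite /qrising -[n in q ^+ n]card_ord -[n in (-1) ^+ n]card_ord -!prodr_const.
by rewrite -!big_split; apply: eq_bigr => i _ /=; field.
Qed.

(** The i-th power contributes (l / q)^i q^n = q^(n-i) l^i, as i <= n; the factor i! offsets the 1 /
    i! built into [stirling1]. *)
Lemma fps_comp_ln1p_dilate (f : fps F) (l q : F) n : q != 0 ->
  fps_comp f (fps_scale (l / q) (fps_dilate q (fps_ln1p F))) n =
  (\sum_(i < n.+1) stirling1 F n i * (q ^+ (n - i) * l ^+ i * (i`!%:R * f i)))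
    / n`!%:R.
Proof.
move=> q0; rewrite mulr_suml; apply: eq_bigr => -[i /= le_in] _.
rewrite fps_exp_scale fps_exp_dilate /fps_dilate /stirling1 expr_div_n.
rewrite -{1}(subnKC (ltnSE le_in)) exprD; set e := fps_exp _ _ _.
by field; rewrite !fact_neq0 expf_neq0.
Qed.

Lemma fps_mul_fact (f g : fps F) n :
  n`!%:R * fps_mul (fun i => f i / i`!%:R) (fun i => g i / i`!%:R) n =
  \sum_(j < n.+1) 'C(n, j)%:R * f (n - j)%N * g j.
Proof.
(* Reversal makes j the index of the second factor; then n! = C(n, j) j! (n - j)!. *)
rewrite /fps_mul mulr_sumr (reindex_inj rev_ord_inj); apply: eq_bigr.
move=> -[j /= le_jn] _; rewrite subSS subKn // -(bin_fact (ltnSE le_jn)) !natrM.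
by field; rewrite !fact_neq0.
Qed.

End CharacteristicZero.

Theorem theorem12 (R : realType) (k : nat) (a q : R) (L : k.-tuple R)
    (la : R[i])
    (hk : (1 <= k)%N) (ha : a != 0) (hq : q != 0)
    (hL : forall i : 'I_k, tnth L i != 0)
    (haj : forall j : nat, a + j%:R != 0)
    (hla : is_power (lprod L) a la)
    (n m : nat) (x : R[i]) :
  polyCauchy_poly m a q L la n x =
  \sum_(j < n.+1) (-1) ^+ (n - j) * 'C(n, j)%:R *
     polyCauchy_number m a q L la j * qrising q%:C x (n - j).
Proof.
have q0 : q%:C != 0 :> R[i] by rewrite fmorph_eq0.
rewrite /polyCauchy_poly /polyCauchy_genfun /fps_scale mulrCA.
set c := la * _ / _.
pose f i := (-1) ^+ i * qrising q%:C x i.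
pose g j := \sum_(i < j.+1) stirling1 R[i] j i *
  (q%:C ^+ (j - i) * (lprod L)%:C ^+ i *
   (i`!%:R * fps_Lif k (a%:C + m%:R) i)).
have -> : fps_mul (fps_inv (fps_dilate q%:C (fps_pow1p (x / q%:C))))
    (fps_comp (fps_Lif k (a%:C + m%:R))
       (fps_scale ((lprod L)%:C / q%:C) (fps_dilate q%:C (fps_ln1p R[i])))) n =
    fps_mul (fun i => f i / i`!%:R) (fun i => g i / i`!%:R) n.
  apply: eq_bigr => i _; rewrite fps_inv_pow1p_dilate.
  by rewrite fps_pow1p_dilate_qrising // fps_comp_ln1p_dilate.
rewrite fps_mul_fact mulr_sumr; apply: eq_bigr => -[j /= _] _.
(* Here [la] moves out of the sum into [c], and the i! in [g] cancels the 1 / i! of [fps_Lif],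
   leaving 1 / (a + i + m)^k. *)
have -> : polyCauchy_number m a q L la j = c * g j.
  rewrite /polyCauchy_number /c [la * _]mulrC -!mulrA; congr (_ * _).
  rewrite [RHS]mulrCA; congr (_ * _).
  rewrite mulr_sumr; apply: eq_bigr => i _.
  rewrite /fps_Lif [i%:R + _]addrC [a%:C + _ + _]addrAC.
  rewrite [i`!%:R * _]mulrC divfK ?pnatr_eq0 -?lt0n ?fact_gt0 //.
  by set d := (_ ^+ k)^-1; ring.
by rewrite /f; ring.
Qed.
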